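(* Assume $\mathsf{CT_Q}$, the principle of unique choice $\mathsf{AUC}$ and Markov's principle $\mathsf{MP}$. Then every model $\mathcal{M}$ of $\mathsf{HA}$ satisfies $\mathcal{M}\cong\mathbb{N}$.
   Context: Meta-theory: constructive type theory (Calculus of Inductive Constructions); propositions in an impredicative universe $\mathbb{P}$, $\exists,\lor$ propositional; no classical axioms assumed. $\mathsf{AUC}$: for all types $X,Y$ and $R:X\to Y\to\mathbb{P}$, if $\forall x\,\exists!y.\,R\,x\,y$ then $\exists f:X\to Y.\ \forall x.\ R\,x\,(f\,x)$. $\mathsf{MP}$: for every $f:\mathbb{N}\to\mathbb{N}$, $\neg\neg(\exists n.\,f\,n=0)\to\exists n.\,f\,n=0$. Arithmetic signature $0,S,+,\times,=$. $\mathsf{HA}$: axioms $\forall x.\, Sx=0\to\bot$; $\forall xy.\, Sx=Sy\to x=y$; $0+x=x$; $(Sx)+y=S(x+y)$; $0\times x=0$; $(Sx)\times y=y+x\times y$; equality axioms (reflexivity, symmetry, transitivity, congruence for $S,+,\times$); induction scheme for every formula; $\vdash$ is intuitionistic natural deduction. $\mathsf{Q}$: same, with induction replaced by $\forall x.\, x=0\lor\exists y.\, x=Sy$. A model $\mathcal{M}$ of $\mathsf{HA}$ is a type with interpretations of $0,S,+,\times$, $=$ interpreted as actual equality, satisfying all $\mathsf{HA}$ axioms under Tarski semantics (connectives/quantifiers interpreted type-theoretically). $\mathcal{M}\cong\mathbb{N}$ means there is a bijective homomorphism $\mathbb{N}\to\mathcal{M}$. A formula is $\Delta_1$ if for every substitution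 $\sigma$ of closed terms $\mathsf{Q}\vdash\varphi[\sigma]$ or $\mathsf{Q}\vdash\neg\varphi[\sigma]$; $\Sigma_1$ if of the form $\exists x_1\dots\exists x_n.\varphi_0$ with $\varphi_0$ $\Delta_1$. $\mathsf{CT_Q}$: for every $f:\mathbb{N}\to\mathbb{N}$ there is a binary $\Sigma_1$-formula $\varphi_f(x,y)$ with $\mathsf{Q}\vdash\forall y.\,\varphi_f(\overline{n},y)\leftrightarrow\overline{f\,n}=y$ for every $n$, where $\overline{n}=S^n0$. *)

(* Defs.v *)
From Stdlib Require Import List FinFun.
Import ListNotations.

(** First-order arithmetic with de Bruijn indices; [$0] is the variable bound by
    the innermost quantifier. *)

Inductive term : Type :=
| var (n : nat)
| zero
| succ (t : term)
| add (s t : term)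
| mul (s t : term).

Inductive form : Type :=
| bot
| eqn (s t : term)
| conj (p q : form)
| disj (p q : form)
| impl (p q : form)
| all (p : form)
| ex (p : form).

Declare Scope arith_scope.
Delimit Scope arith_scope with arith.
Bind Scope arith_scope with term form.
Open Scope arith_scope.

Notation "$ n" := (var n) (at level 3, format "$ n") : arith_scope.
Notation "s '==' t" := (eqn s t) (at level 70, no associativity) : arith_scope.
Notation "p '~>' q" := (impl p q) (at level 85, right associativity)
  : arith_scope.

Definition neg (p : form) : form := p ~> bot.
Definition iff_form (p q : form) : form := conj (p ~> q) (q ~> p).

Fixpoint num (n : nat) : term :=
  match n with
  | O => zero
  | S k => succ (num k)
  end.

Definition scons {X : Type} (x : X) (s : nat -> X) (n : nat) : X :=
  match n with
  | O => x
  | S k => s k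
  end.

Definition shift (n : nat) : term := $(S n).

Fixpoint subst_term (s : nat -> term) (t : term) : term :=
  match t with
  | var n => s n
  | zero => zero
  | succ u => succ (subst_term s u)
  | add u v => add (subst_term s u) (subst_term s v)
  | mul u v => mul (subst_term s u) (subst_term s v)
  end.

Definition up (s : nat -> term) : nat -> term :=
  scons ($0) (fun n => subst_term shift (s n)).

Fixpoint subst (s : nat -> term) (p : form) : form :=
  match p with
  | bot => bot
  | eqn u v => eqn (subst_term s u) (subst_term s v)
  | conj p q => conj (subst s p) (subst s q)
  | disj p q => disj (subst s p) (subst s q)
  | impl p q => impl (subst s p) (subst s q)
  | all p => all (subst (up s) p)
  | ex p => ex (subst (up s) p)
  end.

Definition inst (t : term) : nat -> term := scons t var.

Fixpoint bounded_term (n : nat) (t : term) : Prop :=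
  match t with
  | var k => k < n
  | zero => True
  | succ u => bounded_term n u
  | add u v => bounded_term n u /\ bounded_term n v
  | mul u v => bounded_term n u /\ bounded_term n v
  end.

Fixpoint bounded (n : nat) (p : form) : Prop :=
  match p with
  | bot => True
  | eqn u v => bounded_term n u /\ bounded_term n v
  | conj p q => bounded n p /\ bounded n q
  | disj p q => bounded n p /\ bounded n q
  | impl p q => bounded n p /\ bounded n q
  | all p => bounded (S n) p
  | ex p => bounded (S n) p
  end.

Definition closed_term (t : term) : Prop := bounded_term 0 t.

Reserved Notation "A |- p" (at level 90, no associativity).

Inductive prv : list form -> form -> Prop :=
| prv_ctx A p : In p A -> A |- p
| prv_botE A p : A |- bot -> A |- p
| prv_conjI A p q : A |- p -> A |- q -> A |- conj p q
| prv_conjE1 A p q : A |- conj p q -> A |- p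
| prv_conjE2 A p q : A |- conj p q -> A |- q
| prv_disjI1 A p q : A |- p -> A |- disj p q
| prv_disjI2 A p q : A |- q -> A |- disj p q
| prv_disjE A p q r : A |- disj p q -> p :: A |- r -> q :: A |- r -> A |- r
| prv_implI A p q : p :: A |- q -> A |- p ~> q
| prv_implE A p q : A |- p ~> q -> A |- p -> A |- q
| prv_allI A p : map (subst shift) A |- p -> A |- all p
| prv_allE A p t : A |- all p -> A |- subst (inst t) p
| prv_exI A p t : A |- subst (inst t) p -> A |- ex p
| prv_exE A p q :
    A |- ex p -> p :: map (subst shift) A |- subst shift q -> A |- q
where "A |- p" := (prv A p) : type_scope.

Definition eq_axioms : list form :=
  [ all ($0 == $0);
    all (all ($1 == $0 ~> $0 == $1));
    all (all (all ($2 == $1 ~> $1 == $0 ~> $2 == $0)));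
    all (all ($1 == $0 ~> succ $1 == succ $0));
    all (all (all (all
      ($3 == $2 ~> $1 == $0 ~> add $3 $1 == add $2 $0))));
    all (all (all (all
      ($3 == $2 ~> $1 == $0 ~> mul $3 $1 == mul $2 $0)))) ].

Definition base_axioms : list form :=
  [ all (succ $0 == zero ~> bot);
    all (all (succ $1 == succ $0 ~> $1 == $0));
    all (add zero $0 == $0);
    all (all (add (succ $1) $0 == succ (add $1 $0)));
    all (mul zero $0 == zero);
    all (all (mul (succ $1) $0 == add $0 (mul $1 $0))) ].

(** [p] may have parameters: its induction variable is [$0], and the remaining
    free variables stay free in the axiom. *)
Definition induction (p : form) : form :=
  subst (inst zero) p
  ~> all (p ~> subst (scons (succ $0) shift) p)
  ~> all p.

Inductive HA : form -> Prop :=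
| HA_eq p : In p eq_axioms -> HA p
| HA_base p : In p base_axioms -> HA p
| HA_induction p : HA (induction p).

Definition Q : list form :=
  eq_axioms ++ base_axioms ++ [ all (disj ($0 == zero) (ex ($1 == succ $0))) ].

Record structure : Type := Structure {
  carrier :> Type;
  s_zero : carrier;
  s_succ : carrier -> carrier;
  s_add : carrier -> carrier -> carrier;
  s_mul : carrier -> carrier -> carrier
}.

Fixpoint eval (M : structure) (e : nat -> M) (t : term) : M :=
  match t with
  | var n => e n
  | zero => s_zero M
  | succ u => s_succ M (eval M e u)
  | add u v => s_add M (eval M e u) (eval M e v)
  | mul u v => s_mul M (eval M e u) (eval M e v)
  end.

Fixpoint sat (M : structure) (e : nat -> M) (p : form) : Prop :=
  match p with
  | bot => False
  | eqn u v => eval M e u = eval M e v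
  | conj p q => sat M e p /\ sat M e q
  | disj p q => sat M e p \/ sat M e q
  | impl p q => sat M e p -> sat M e q
  | all p => forall d : M, sat M (scons d e) p
  | ex p => exists d : M, sat M (scons d e) p
  end.

Definition HA_model (M : structure) : Prop :=
  forall p, HA p -> forall e : nat -> M, sat M e p.

Definition standard_model : structure := Structure nat 0 S Nat.add Nat.mul.

Definition homomorphism (M N : structure) (f : M -> N) : Prop :=
  f (s_zero M) = s_zero N
  /\ (forall x, f (s_succ M x) = s_succ N (f x))
  /\ (forall x y, f (s_add M x y) = s_add N (f x) (f y))
  /\ (forall x y, f (s_mul M x y) = s_mul N (f x) (f y)).

Definition isomorphic (M N : structure) : Prop :=
  exists f : M -> N, homomorphism M N f /\ Bijective f.

Definition Delta1 (p : form) : Prop :=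
  forall s : nat -> term, (forall n, closed_term (s n)) ->
  (Q |- subst s p) \/ (Q |- neg (subst s p)).

Definition Sigma1 (p : form) : Prop :=
  exists n p0, Delta1 p0 /\ p = Nat.iter n ex p0.

(** In the binary formula [p], [$0] stands for x and [$1] for y; instantiating
    [$0] turns [$1] into [$0], which the outer quantifier then binds. *)
Definition CT_Q : Prop :=
  forall f : nat -> nat, exists p : form,
    bounded 2 p /\ Sigma1 p /\
    forall n, Q |- all (iff_form (subst (inst (num n)) p) (num (f n) == $0)).

Definition AUC : Prop :=
  forall (X Y : Type) (R : X -> Y -> Prop),
    (forall x, exists! y, R x y) -> exists f : X -> Y, forall x, R x (f x).

Definition MP : Prop :=
  forall f : nat -> nat, ~ ~ (exists n, f n = 0) -> exists n, f n = 0.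

(* Main.v *)
(** In a model [M] of HA the disjunctions of the object language are those of the
    metatheory. Hence HA, which proves by induction on [b] that a formula is not
    not decidable for all arguments below [b], yields from a nonstandard [b] and
    AUC, under a double negation, a decision function on the naturals for any
    formula of [M].

    Apply this to a Rosser formula built from a CT_Q-representation of the
    function that enumerates the pairs (formula [p] with code [n], bit [b]) for
    which Q proves that [p] has value [b] at [n]: the formula holds at [n] when
    the bit is 0 and fails at [n] when the bit is 1. A decision function for it
    is itself represented by some formula [p], and evaluating at the code of [p]
    is contradictory. So no element is nonstandard; since being equal to a given
    numeral is decidable, AUC and MP find for each element the numeral it equals. *)

From HB Require Import structures.
From mathcomp Require Import all_boot.
Require Import Defs.

Set Implicit Arguments.
Unset Strict Implicit.
Unset Printing Implicit Defensive.

(** * Enumerating the theorems of a finite context *)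

(** Trees over a countable type are countable, so this encoding provides decidable equality and a
    numbering by [pickle]. *)
Fixpoint term_tree (t : term) : GenTree.tree nat :=
  match t with
  | var n => GenTree.Leaf n
  | zero => GenTree.Node 0 [::]
  | succ u => GenTree.Node 1 [:: term_tree u]
  | add u v => GenTree.Node 2 [:: term_tree u; term_tree v]
  | mul u v => GenTree.Node 3 [:: term_tree u; term_tree v]
  end.

Fixpoint tree_term (T : GenTree.tree nat) : term :=
  match T with
  | GenTree.Leaf n => var n
  | GenTree.Node 1 [:: U] => succ (tree_term U)
  | GenTree.Node 2 [:: U; V] => add (tree_term U) (tree_term V)
  | GenTree.Node 3 [:: U; V] => mul (tree_term U) (tree_term V)
  | _ => zero
  end.

Lemma term_treeK : cancel term_tree tree_term.
Proof. by elim=> //= [u -> | u -> v -> | u -> v ->]. Qed.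

HB.instance Definition _ := Countable.copy term (can_type term_treeK).

Fixpoint form_tree (p : form) : GenTree.tree (term * term) :=
  match p with
  | bot => GenTree.Node 0 [::]
  | eqn s t => GenTree.Leaf (s, t)
  | conj p q => GenTree.Node 1 [:: form_tree p; form_tree q]
  | disj p q => GenTree.Node 2 [:: form_tree p; form_tree q]
  | impl p q => GenTree.Node 3 [:: form_tree p; form_tree q]
  | all p => GenTree.Node 4 [:: form_tree p]
  | ex p => GenTree.Node 5 [:: form_tree p]
  end.

Fixpoint tree_form (T : GenTree.tree (term * term)) : form :=
  match T with
  | GenTree.Leaf (s, t) => eqn s t
  | GenTree.Node 1 [:: U; V] => conj (tree_form U) (tree_form V)
  | GenTree.Node 2 [:: U; V] => disj (tree_form U) (tree_form V)
  | GenTree.Node 3 [:: U; V] => impl (tree_form U) (tree_form V)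
  | GenTree.Node 4 [:: U] => all (tree_form U)
  | GenTree.Node 5 [:: U] => ex (tree_form U)
  | _ => bot
  end.

Lemma form_treeK : cancel form_tree tree_form.
Proof.
by elim=> //= [p -> q -> | p -> q -> | p -> q -> | p -> | p ->].
Qed.

HB.instance Definition _ := Countable.copy form (can_type form_treeK).

Definition sequent : Type := (seq form * form)%type.

(** A line of a derivation carries, besides its sequent, the two formulas and
    the term that the last rule may mention only in its premises; this makes the
    correctness of a line decidable. *)
Definition line : Type := (sequent * (form * form * term))%type.

Definition intro_step (G : seq sequent) (A : seq form) (p : form) (t : term) :=
  match p with
  | conj a b => ((A, a) \in G) && ((A, b) \in G)
  | disj a b => ((A, a) \in G) || ((A, b) \in G)
  | impl a b => (a :: A, b) \in G
  | all a => (List.map (subst shift) A, a) \in G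
  | ex a => (A, subst (inst t) a) \in G
  | _ => false
  end.

Definition step (G : seq sequent) (x : line) : bool :=
  let: ((A, p), (q, r, t)) := x in
  let pr B s := (B, s) \in G in
  [|| p \in A, pr A bot, intro_step G A p t,
      pr A (conj p q), pr A (conj q p),
      [&& pr A (disj q r), pr (q :: A) p & pr (r :: A) p],
      pr A (impl q p) && pr A q,
      pr A (all q) && eq_op p (subst (inst t) q) |
      pr A (ex q) && pr (q :: List.map (subst shift) A) (subst shift p)].

(** The newest line stands first, so a line may cite only those behind it. *)
Fixpoint valid (l : seq line) : bool :=
  if l is x :: l' then step (map fst l') x && valid l' else true.

Lemma mem_In (T : eqType) (x : T) (s : seq T) : reflect (List.In x s) (x \in s).
Proof.
elim: s => [|y s IH]; first by constructor.
rewrite inE; apply: (iffP orP) => -[].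
- by move/eqP->; left.
- by move/IH; right.
- by move->; left.
- by move/IH; right.
Qed.

Lemma step_sound (G : seq sequent) (A : seq form) (p : form) z :
  (forall s, s \in G -> s.1 |- s.2) -> step G ((A, p), z) -> A |- p.
Proof.
case: z => -[q r] t HG /=.
have pr B s : (B, s) \in G -> B |- s by move/HG.
case/or4P.
- by move/mem_In/prv_ctx.
- by move/pr/prv_botE.
- case: p => //.
  + by move=> a b /andP[/pr Ha /pr Hb]; apply: prv_conjI.
  + by move=> a b /orP[/pr Ha|/pr Hb]; [apply: prv_disjI1|apply: prv_disjI2].
  + by move=> a b /pr; apply: prv_implI.
  + by move=> a /pr; apply: prv_allI.
  + by move=> a /pr; apply: prv_exI.
case/or4P.
- by move/pr/prv_conjE1.
- by move/pr/prv_conjE2.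
- by case/and3P=> /pr H /pr H1 /pr; apply: prv_disjE H H1.
case/or3P.
- by case/andP=> /pr H /pr; apply: prv_implE.
- by case/andP=> /pr H /eqP->; apply: prv_allE.
- by case/andP=> /pr H /pr; apply: prv_exE.
Qed.

Lemma valid_sound (l : seq line) s :
  valid l -> s \in map fst l -> s.1 |- s.2.
Proof.
elim: l s => [|[[A p] z] l IH] //= s /andP[Hs Hl].
rewrite inE => /predU1P[->|]; last exact: IH.
by apply: (step_sound _ Hs) => s'; apply: IH.
Qed.

Lemma step_mono (G G' : seq sequent) x :
  {subset G <= G'} -> step G x -> step G' x.
Proof.
case: x => -[A p] [[q r] t] sub /=.
have pr B s : (B, s) \in G -> (B, s) \in G' by move/sub.
have intro: intro_step G A p t -> intro_step G' A p t.
  case: p => //= [a b|a b|a b|a|a]; try exact: pr.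
    by case/andP=> /pr-> /pr->.
  by case/orP=> /pr->; rewrite ?orbT.
case/or4P=> [->//|/pr->|/intro->|]; rewrite ?orbT //.
case/or4P=> [/pr->|/pr->|/and3P[/pr-> /pr-> /pr->]|]; rewrite ?orbT //.
by case/or3P=> /andP[/pr->]; [move/pr->|move->|move/pr->]; rewrite ?orbT.
Qed.

Lemma valid_cat (l l' : seq line) : valid l -> valid l' -> valid (l ++ l').
Proof.
move=> + Hl'; elim: l => //= x l IH /andP[Hx /IH->]; rewrite andbT.
by apply: step_mono Hx => s; rewrite map_cat mem_cat => ->.
Qed.

Definition derivable (s : sequent) : Prop :=
  exists2 l, valid l & s \in map fst l.

Lemma derivable_seq (G : seq sequent) :
  (forall s, s \in G -> derivable s) ->
  exists2 l, valid l & {subset G <= map fst l}.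
Proof.
elim: G => [|s G IH] H; first by exists [::].
have [l1 V1 S1] := H s (mem_head _ _).
have [|l2 V2 S2] := IH; first by move=> s' Hs'; apply: H; rewrite inE Hs' orbT.
exists (l1 ++ l2); first exact: valid_cat.
move=> s'; rewrite inE map_cat mem_cat => /predU1P[->|/S2->].
  by rewrite S1.
by rewrite orbT.
Qed.

Lemma derivable_step (G : seq sequent) s z :
  (forall s, s \in G -> derivable s) -> step G (s, z) -> derivable s.
Proof.
move=> /derivable_seq[l Vl Sl] Hs; exists ((s, z) :: l); last exact: mem_head.
by rewrite /= Vl andbT; apply: step_mono Hs.
Qed.

Lemma derivable_complete (A : seq form) (p : form) : A |- p -> derivable (A, p).
Proof.
have one (s : sequent) :
    derivable s -> forall s', s' \in [:: s] -> derivable s'.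
  by move=> H s'; rewrite inE => /eqP->.
have two (s1 s2 : sequent) : derivable s1 -> derivable s2 ->
    forall s', s' \in [:: s1; s2] -> derivable s'.
  by move=> H1 H2 s'; rewrite !inE => /orP[]/eqP->.
elim=> {A p} [A p /mem_In Hp|A p _ /one H|A p q _ H _ /(two _ _ H) {}H
  |A p q _ /one H|A p q _ /one H|A p q _ /one H|A p q _ /one H
  |A p q r _ H _ H1 _ H2|A p q _ /one H|A p q _ H _ /(two _ _ H) {}H
  |A p _ /one H|A p t _ /one H|A p t _ /one H|A p q _ H _ /(two _ _ H) {}H].
(* [bot] and [zero] fill the slots of a line that the rule at hand leaves free. *)
- by apply: (@derivable_step [::] _ (bot, bot, zero)); rewrite //= Hp.
- by apply: (derivable_step H (z := (bot, bot, zero))); rewrite /= mem_head orbT.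
- apply: (derivable_step H (z := (bot, bot, zero))).
  by rewrite /= !inE !eqxx !orbT.
- apply: (derivable_step H (z := (q, bot, zero))).
  by rewrite /= !inE !eqxx !orbT.
- apply: (derivable_step H (z := (p, bot, zero))).
  by rewrite /= !inE !eqxx !orbT.
- apply: (derivable_step H (z := (bot, bot, zero))).
  by rewrite /= !inE !eqxx !orbT.
- apply: (derivable_step H (z := (bot, bot, zero))).
  by rewrite /= !inE !eqxx !orbT.
- have H3 s' : s' \in [:: (A, disj p q); (p :: A, r); (q :: A, r)] ->
      derivable s' by rewrite !inE => /or3P[]/eqP->.
  apply: (derivable_step H3 (z := (p, q, zero))).
  by rewrite /= !inE !eqxx !orbT.
- apply: (derivable_step H (z := (bot, bot, zero))).
  by rewrite /= !inE !eqxx !orbT.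
- apply: (derivable_step H (z := (p, bot, zero))).
  by rewrite /= !inE !eqxx !orbT.
- apply: (derivable_step H (z := (bot, bot, zero))).
  by rewrite /= !inE !eqxx !orbT.
- apply: (derivable_step H (z := (p, bot, t))).
  by rewrite /= !inE !eqxx !orbT.
- apply: (derivable_step H (z := (bot, bot, t))).
  by rewrite /= !inE !eqxx !orbT.
- apply: (derivable_step H (z := (p, bot, zero))).
  by rewrite /= !inE !eqxx !orbT.
Qed.

Lemma prv_enumerable (A : seq form) :
  exists h : nat -> option form, forall p, A |- p <-> exists k, h k = Some p.
Proof.
(* A number codes a formula with a candidate derivation; [None] absorbs the codes that fail the
   check. *)
pose h k := if unpickle k is Some (p, l) then
    if valid l && ((A, p) \in map fst l) then Some p else None
  else None.
exists h => p; split.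
  move/derivable_complete=> [l Vl Sl]; exists (pickle (p, l)).
  by rewrite /h pickleK Vl Sl.
case=> k; rewrite /h; case: (unpickle k) => [[q l]|] //.
case: ifP => // /andP[Vl Sl] [<-]; exact: valid_sound Vl Sl.
Qed.

(** * Soundness *)

(** Functional extensionality is not assumed, so environments are compared pointwise. *)
Lemma eval_ext (M : structure) (e e' : nat -> M) t :
  e =1 e' -> eval M e t = eval M e' t.
Proof. by move=> E; elim: t => //= [u -> | u -> v -> | u -> v ->]. Qed.

Lemma scons_ext (X : Type) (x : X) (e e' : nat -> X) :
  e =1 e' -> scons x e =1 scons x e'.
Proof. by move=> E []. Qed.

Lemma sat_ext (M : structure) p (e e' : nat -> M) :
  e =1 e' -> sat M e p <-> sat M e' p.
Proof.
elim: p e e' => //= [s t|p IHp q IHq|p IHp q IHq|p IHp q IHq|p IHp|p IHp] e e' E.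
- by rewrite !(eval_ext _ E).
- by move: (IHp _ _ E) (IHq _ _ E); tauto.
- by move: (IHp _ _ E) (IHq _ _ E); tauto.
- by move: (IHp _ _ E) (IHq _ _ E); tauto.
- by split=> H d; apply/(IHp _ _ (scons_ext d E)).
- by split=> -[d H]; exists d; apply/(IHp _ _ (scons_ext d E)).
Qed.

Lemma eval_subst (M : structure) (e : nat -> M) s t :
  eval M e (subst_term s t) = eval M (fun n => eval M e (s n)) t.
Proof. by elim: t => //= [u -> | u -> v -> | u -> v ->]. Qed.

Lemma eval_up (M : structure) (e : nat -> M) d s :
  (fun n => eval M (scons d e) (up s n)) =1 scons d (fun n => eval M e (s n)).
Proof. by case=> //= n; rewrite eval_subst; apply: eval_ext. Qed.

Lemma sat_subst (M : structure) p (e : nat -> M) s :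
  sat M e (subst s p) <-> sat M (fun n => eval M e (s n)) p.
Proof.
elim: p e s => //= [u v|p IHp q IHq|p IHp q IHq|p IHp q IHq|p IHp|p IHp] e s.
- by rewrite !eval_subst.
- by move: (IHp e s) (IHq e s); tauto.
- by move: (IHp e s) (IHq e s); tauto.
- by move: (IHp e s) (IHq e s); tauto.
- have E d := iff_trans (IHp (scons d e) (up s)) (sat_ext p (eval_up e d s)).
  by split=> H d; apply/E/H.
- have E d := iff_trans (IHp (scons d e) (up s)) (sat_ext p (eval_up e d s)).
  by split=> -[d H]; exists d; apply/E/H.
Qed.

Lemma sat_inst (M : structure) p (e : nat -> M) t :
  sat M e (subst (inst t) p) <-> sat M (scons (eval M e t) e) p.
Proof. by rewrite sat_subst; apply: sat_ext; case. Qed.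

Lemma sat_shift (M : structure) p (e : nat -> M) d :
  sat M (scons d e) (subst shift p) <-> sat M e p.
Proof. exact: sat_subst. Qed.

Lemma sat_shift_ctx (M : structure) A (e : nat -> M) d :
  (forall q, List.In q A -> sat M e q) ->
  forall q, List.In q (List.map (subst shift) A) -> sat M (scons d e) q.
Proof.
by move=> H _ /List.in_map_iff[q [<- Hq]]; apply/sat_shift/H.
Qed.

Lemma soundness (M : structure) A p : A |- p ->
  forall e : nat -> M, (forall q, List.In q A -> sat M e q) -> sat M e p.
Proof.
have ctx B r e : (forall q, List.In q B -> sat M e q) -> sat M e r ->
    forall q, List.In q (r :: B) -> sat M e q.
  by move=> HB Hr q [<-//|]; apply: HB.
elim=> {A p} /=.
- by move=> A p Hp e; apply.
- by move=> A p _ IH e /IH.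
- by move=> A p q _ IH1 _ IH2 e H; split; [apply: IH1|apply: IH2].
- by move=> A p q _ IH e /IH[].
- by move=> A p q _ IH e /IH[].
- by move=> A p q _ IH e /IH; left.
- by move=> A p q _ IH e /IH; right.
- by move=> A p q r _ IH _ IH1 _ IH2 e H; case: (IH e H) => ?;
    [apply: IH1|apply: IH2]; apply: ctx.
- by move=> A p q _ IH e H Hp; apply/IH/ctx.
- by move=> A p q _ IH1 _ IH2 e H; apply: IH1 (H) (IH2 e H).
- by move=> A p _ IH e H d; apply/IH/sat_shift_ctx.
- by move=> A p t _ IH e H; apply/sat_inst/IH.
- by move=> A p t _ IH e H; exists (eval M e t); apply/sat_inst/IH.
- move=> A p q _ IH1 _ IH2 e H; have [d Hd] := IH1 e H.
  by apply/(sat_shift q e d)/IH2/ctx => //; apply: sat_shift_ctx.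
Qed.

(** * Models of arithmetic *)

Fixpoint std (M : structure) (n : nat) : M :=
  if n is k.+1 then s_succ M (std M k) else s_zero M.

Lemma eval_num (M : structure) (e : nat -> M) n : eval M e (num n) = std M n.
Proof. by elim: n => //= n ->. Qed.

Lemma sat_induction (M : structure) (p : form) (e : nat -> M) : HA_model M ->
  sat M (scons (s_zero M) e) p ->
  (forall d, sat M (scons d e) p -> sat M (scons (s_succ M d) e) p) ->
  forall d, sat M (scons d e) p.
Proof.
move=> HM H0 HS; apply: (HM _ (HA_induction p) e); first exact/sat_inst.
move=> d /HS H; have E : (fun n => eval M (scons d e)
    (scons (succ (var O)) shift n)) =1 scons (s_succ M d) e by case.
exact/sat_subst/(sat_ext p E).
Qed.

Section Model.
Context (M : structure) (HM : HA_model M).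

Local Notation "0" := (s_zero M).
Local Notation S := (s_succ M).
Local Infix "+" := (s_add M).
Local Infix "*" := (s_mul M).
Local Notation n_ := (std M).
Let e0 : nat -> M := fun=> 0.

Lemma model_succ_neq0 x : S x <> 0.
Proof. by have := HM (HA_base _ (or_introl erefl)) e0; apply. Qed.

Lemma model_succ_inj : injective S.
Proof.
by have := HM (HA_base _ (or_intror (or_introl erefl))) e0; move=> /= H x y; apply: H.
Qed.

Lemma model_add0 x : 0 + x = x.
Proof.
by have := HM (HA_base _ (or_intror (or_intror (or_introl erefl)))) e0; apply.
Qed.

Lemma model_addS x y : S x + y = S (x + y).
Proof.
have := HM (HA_base _ (or_intror (or_intror (or_intror (or_introl erefl))))) e0.
by apply.
Qed.

Lemma model_mul0 x : 0 * x = 0.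
Proof.
have := HM (HA_base _ (or_intror (or_intror (or_intror (or_intror
  (or_introl erefl)))))) e0.
by apply.
Qed.

Lemma model_mulS x y : S x * y = y + x * y.
Proof.
have := HM (HA_base _ (or_intror (or_intror (or_intror (or_intror (or_intror
  (or_introl erefl))))))) e0.
by apply.
Qed.

(** Induction supplies the axiom of [Q] that [HA] does not list, here as a case distinction in the
    metatheory. *)
Lemma model_case x : x = 0 \/ exists y, x = S y.
Proof.
pose p := disj (eqn (var 0) zero) (ex (eqn (var 1) (succ (var 0)))).
apply: (sat_induction (p := p) (e := e0) HM); first by left.
by move=> d _; right; exists d.
Qed.

Lemma model_addr0 x : x + 0 = x.
Proof.
pose p := eqn (add (var 0) zero) (var 0).
apply: (sat_induction (p := p) (e := e0) HM) => /=; first exact: model_add0.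
by move=> d IH; rewrite model_addS IH.
Qed.

Lemma model_add_succ x y : x + S y = S (x + y).
Proof.
pose p := eqn (add (var 0) (succ (var 1))) (succ (add (var 0) (var 1))).
apply: (sat_induction (p := p) (e := scons y e0) HM) => /=.
  by rewrite !model_add0.
by move=> d IH; rewrite !model_addS IH.
Qed.

Lemma model_Q e q : List.In q Q -> sat M e q.
Proof.
move=> /List.in_app_iff[|/List.in_app_iff[|[<-|//]]].
- by move=> Hq; apply: HM (HA_eq _ Hq) e.
- by move=> Hq; apply: HM (HA_base _ Hq) e.
- by move=> d; apply: model_case.
Qed.

Lemma std_inj : injective n_.
Proof.
elim=> [|m IH] [|n] //=; first by move/esym/model_succ_neq0.
  by move/model_succ_neq0.
by move/model_succ_inj/IH->.
Qed.

Lemma std_add m n : n_ (addn m n) = n_ m + n_ n.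
Proof. by elim: m => [|m /= ->]; rewrite ?model_add0 ?model_addS. Qed.

Lemma std_mul m n : n_ (muln m n) = n_ m * n_ n.
Proof.
elim: m => [|m IH]; first by rewrite model_mul0.
by rewrite mulSn std_add IH -model_mulS.
Qed.

(** Induction on [k]: each step asks [model_case] whether the remainder [s] is zero. *)
Lemma std_or_ge k x : (exists2 j, (j < k)%N & x = n_ j) \/ exists s, x = s + n_ k.
Proof.
elim: k => [|k [[j Hj ->]|[s ->]]].
- by right; exists x; rewrite /= model_addr0.
- by left; exists j => //; apply: ltnW.
- have [->|[s' ->]] := model_case s.
    by left; exists k => //; rewrite model_add0.
  by right; exists s'; rewrite model_addS /= model_add_succ.
Qed.

(** Two summands fit the inequalities met in [rosser_true] without associativity of addition. *)
Lemma std_not_ge k s s' : n_ k <> s + (s' + n_ k.+1).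
Proof.
elim: k => [|k IH] /=; rewrite !model_add_succ.
  by move/esym/model_succ_neq0.
by move/model_succ_inj; rewrite -/n_ -!model_add_succ; apply: IH.
Qed.

Lemma std_dec x n : x = n_ n \/ x <> n_ n.
Proof.
have [[j _ ->]|[s ->]] := std_or_ge n.+1 x.
  by have [->|/eqP neq] := eqVneq j n; [left|right=> /std_inj].
right=> /esym; rewrite -(model_add0 (s + _)); exact: std_not_ge.
Qed.

(** * Represented functions and Rosser's trick *)

Definition represents (p : form) (f : nat -> nat) : Prop :=
  forall k (e : nat -> M) d,
  sat M (scons (n_ k) (scons d e)) p <-> n_ (f k) = d.

Definition value (p : form) (k m : nat) : form :=
  all (iff_form (subst (inst (num k)) p) (eqn (num m) (var 0))).

Lemma value_sat p k m (e : nat -> M) d : prv Q (value p k m) ->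
  sat M (scons (n_ k) (scons d e)) p <-> n_ m = d.
Proof.
move=> /soundness/(_ e (@model_Q e))/(_ d) /= [].
by move: (sat_inst p (scons d e) (num k)); rewrite !eval_num /=; tauto.
Qed.

(** Soundness in [M] stands in for consistency of [Q]: both numerals denote the same element. *)
Lemma value_inj p k m m' : prv Q (value p k m) -> prv Q (value p k m') -> m = m'.
Proof.
move=> H H'; apply: std_inj; symmetry.
exact/(value_sat e0 _ H')/(value_sat e0 _ H).
Qed.

(** [rosser p] says of [x] that [2x+1] occurs among the values of the function
    represented by [p], and not later than any occurrence of [2x+2]. *)
Definition rosser (p : form) : form :=
  ex (conj (subst (scons (var 0) (fun=> succ (add (var 1) (var 1)))) p)
    (all (impl (ex (eqn (var 2) (add (var 0) (var 1))))
      (neg (subst (scons (var 0)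
        (fun=> succ (succ (add (var 2) (var 2))))) p))))).

Lemma represents_subst p f t u k (e : nat -> M) : represents p f ->
  eval M e t = n_ k ->
  sat M e (subst (scons t (fun=> u)) p) <-> n_ (f k) = eval M e u.
Proof.
move=> Hp Ht; rewrite -(Hp k (fun=> eval M e u)) sat_subst.
by apply: sat_ext => -[|[|n]].
Qed.

(** Elements up to the numeral of [k] are standard, so the bounded quantifier meets only actual
    values of [f]. *)
Lemma rosser_true p f n k (e : nat -> M) : represents p f ->
  f k = (n + n).+1%N -> (forall j, f j <> (n + n).+2%N) ->
  sat M (scons (n_ n) e) (rosser p).
Proof.
move=> Hp Hk Hj; exists (n_ k); split.
  apply/(represents_subst (k := k) _ Hp) => //=.
  by rewrite Hk /= std_add.
move=> d [s /= Hs].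
have [[j _ Dj]|[s' Ds]] := std_or_ge k.+1 d; last first.
  by case: (@std_not_ge k s s'); rewrite -Ds.
move/(represents_subst (k := j) _ Hp) => /(_ Dj) /=.
by rewrite -std_add => /(@std_inj _ (n + n).+2%N)/Hj.
Qed.

(** A witness [d] may be nonstandard, where [Hj] says nothing. Below [k] it is standard and
    excluded; from [k] on, the occurrence of 2n+2 at [k] comes no later than [d]. *)
Lemma rosser_false p f n k (e : nat -> M) : represents p f ->
  f k = (n + n).+2%N -> (forall j, f j <> (n + n).+1%N) ->
  ~ sat M (scons (n_ n) e) (rosser p).
Proof.
move=> Hp Hk Hj [d [Hd Hmin]].
have [[j _ Dj]|[s Ds]] := std_or_ge k d.
  move/(represents_subst (k := j) _ Hp): Hd => /(_ Dj) /=.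
  by rewrite -std_add => /(@std_inj _ (n + n).+1%N)/Hj.
apply: (Hmin (n_ k)); first by exists s.
apply/(represents_subst (k := k) _ Hp) => //=.
by rewrite Hk /= std_add.
Qed.

(** Excluded middle cannot be assumed pointwise, but its double negation is
    provable for all elements below a given one at once, and below a nonstandard
    element lie all the standard ones. *)
Lemma decidable_below p (e : nat -> M) b :
  ~ ~ (forall x, (exists s, b = s + S x) ->
         sat M (scons x e) p \/ ~ sat M (scons x e) p).
Proof.
(* In [q], variable 1 is the bound, so the parameters of [p] skip over it. *)
pose p' := subst (scons (var 0) (fun n => var (n.+2))) p.
pose q := neg (neg (all (impl (ex (eqn (var 2) (add (var 0) (succ (var 1)))))
  (disj p' (neg p'))))).
have E d x : sat M (scons x (scons d e)) p' <-> sat M (scons x e) p.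
  by rewrite sat_subst; apply: sat_ext => -[].
suff : sat M (scons b e) q.
  by move=> /= H1 H2; apply: H1 => H1; apply: H2 => x /H1; rewrite E.
apply: (sat_induction HM) => /=.
  move=> H; apply: H => x [s]; rewrite model_add_succ.
  by move/esym/model_succ_neq0.
(* The goal is [False], so double negations can be stripped; the only new instance is [x = d]. *)
move=> d IH H; apply: (IH) => {}IH.
have : ~ ~ (sat M (scons d e) p \/ ~ sat M (scons d e) p) by tauto.
apply=> Hd; apply: H => x [s]; rewrite E model_add_succ.
move/model_succ_inj; have [->|[s' ->]] := model_case s.
  by rewrite model_add0 => <-.
rewrite model_addS -model_add_succ => Dd.
by rewrite -(E d); apply: IH; exists s'.
Qed.

End Model.

(** * Diagonalisation and standardness of all elements *)

Lemma self_value_enumerable : exists f : nat -> nat,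
  forall p (b : bool), let n := pickle p in
  prv Q (value p n b) <-> exists k, f k = (n + n + b).+1.
Proof.
have [h Hh] := prv_enumerable Q.
(* Bit [b] at code [n] is recorded as 2n+1+b; the default 0 records nothing. *)
pose f k := if (unpickle k : option (form * bool * nat)) is Some (p, b, j) then
    let n := pickle p in
    if eq_op (h j) (Some (value p n b)) then (n + n + nat_of_bool b).+1 else 0%N
  else 0%N.
exists f => p b n; split.
  by move/Hh=> [j Hj]; exists (pickle (p, b, j)); rewrite /f pickleK Hj eqxx.
case=> k; rewrite /f; case: (unpickle k) => [[[q c] j]|] //.
case: eqP => // /(ex_intro _ j)/Hh Hq [].
(* Parity recovers the bit, then halving recovers the code. *)
rewrite !addnn => E.
have Ec : c = b by move: (congr1 odd E); rewrite !oddD !odd_double !oddb.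
by move: E Hq; rewrite Ec => /addIn/double_inj/(pcan_inj pickleK) ->.
Qed.

(** The boolean equivalent to [P n] is unique, so unique choice turns a propositional disjunction
    into a function. *)
Lemma AUC_decide (auc : AUC) (P : nat -> Prop) :
  (forall n, P n \/ ~ P n) -> exists g : nat -> bool, forall n, P n <-> g n.
Proof.
move=> dec; have [|g Hg] := auc nat bool (fun n b => P n <-> b).
  move=> n; have [H|H] := dec n; [exists true | exists false].
    by split=> // -[] // [/(_ H)].
  by split; [split|case=> // -[_ /(_ isT)]].
by exists g.
Qed.

Lemma no_nonstandard (ct : CT_Q) (auc : AUC) (M : structure)
  (HM : HA_model M) (x : M) : ~ ~ exists n, x = std M n.
Proof.
move=> nonstd.
have [f Hf] := self_value_enumerable.
have [r [_ [_ Hr]]] := ct f.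
have Rr : represents M r f by move=> k e d; apply: value_sat (Hr k).
pose e (_ : nat) := x.
apply: (@decidable_below M HM (rosser r) e x) => dec.
pose P n := sat M (scons (std M n) e) (rosser r).
have [n|g Hg] := @AUC_decide auc P.
  (* Were [x] not above the numeral of [n], it would itself be a numeral. *)
  apply: dec; have [[j _ Hj]|[s ->]] := std_or_ge HM n.+1 x.
    by case: nonstd; exists j.
  by exists s.
(* Diagonal step: [f] records the value of [p] at its own code, which is the verdict of [g]
   there. *)
have [p [_ [_ Hp]]] := ct (fun n => g n : nat).
have Hpn := Hp (pickle p); set n := pickle p in Hpn.
have [k Hk] := (Hf p (g n)).1 Hpn.
have other j : f j <> (n + n + ~~ g n).+1.
  move=> Hj; have /(value_inj HM Hpn) := (Hf p (~~ g n)).2 (ex_intro _ j Hj).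
  by case: (g n).
(* Verdict true puts 2n+2 among the values of [f] and refutes the Rosser formula; verdict false puts
   2n+1 there and proves it. *)
move: Hk other (Hg n); case: (g n) => /=; rewrite addn0 addn1 => Hk other Pn.
  exact: (rosser_false HM Rr Hk other) (Pn.2 isT).
by have := Pn.1 (rosser_true HM e Rr Hk other).
Qed.

Lemma all_standard (ct : CT_Q) (auc : AUC) (mp : MP) (M : structure)
  (HM : HA_model M) (x : M) : exists n, x = std M n.
Proof.
have [g Hg] := AUC_decide auc (std_dec HM x).
(* [MP] searches for a zero, hence the negated bit. *)
have [|n Hn] := mp (fun n => ~~ g n : nat); last first.
  by exists n; apply/Hg; case: (g n) Hn.
move=> H; apply: (no_nonstandard ct auc HM (x := x)) => -[n /Hg Hn].
by apply: H; exists n; rewrite Hn.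
Qed.

Theorem theorem7p19 (ct : CT_Q) (auc : AUC) (mp : MP)
  (M : structure) (HM : HA_model M) : isomorphic standard_model M.
Proof.
(* [Bijective] asks for an inverse function; unique choice extracts it. *)
have [x|g Hg] := auc M nat (fun x n => x = std M n).
  have [n ->] := all_standard ct auc mp HM x.
  by exists n; split=> // m /(std_inj HM).
exists (std M); split.
  by split=> //; split=> //; split=> m n; [apply: std_add|apply: std_mul].
exists g; split=> [n|x]; last by rewrite -Hg.
by apply: (std_inj HM); rewrite -Hg.
Qed.
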